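(* Let $p:\mathsf{E}\to\mathsf{B}$ be a fibration and consider its simple coproduct completion $\mathfrak{Sum}(p)$. Let $I$ be an object of $\mathsf{B}$ and let $\alpha$ be an object of the fibre $\mathsf{E}_I$. Then every object of the form $(I,1,\alpha)$ in the fibre $\mathfrak{Sum}(p)_I$ is a $\coprod$-quantifier-free element of $\mathfrak{Sum}(p)$.
   Context: Conventions. All fibrations are cloven and split (reindexing is strictly functorial) and have a base category with finite products, with terminal object $1$. For $p:\mathsf{E}\to\mathsf{B}$ and $I\in\mathsf{B}$, $\mathsf{E}_I$ is the fibre category over $I$ (its arrows are called vertical); for $u:A\to B$ in $\mathsf{B}$, $u^*:\mathsf{E}_B\to\mathsf{E}_A$ is reindexing. $I\times 1$ is identified with $I$, so $\alpha\in\mathsf{E}_I$ is regarded as an object of $\mathsf{E}_{I\times 1}$. Simple coproducts. A fibration has simple coproducts if for every projection $\pi_I:I\times X\to I$ the functor $\pi_I^*$ has a left adjoint $\coprod_{\pi_I}$, and for every $f:I\to J$ the canonical map $\coprod_{\pi_I}(f\times 1_X)^*\to f^*\coprod_{\pi_J}$ is invertible. Simple coproduct completion. $\mathfrak{Sum}(p)$ has as objects triples $(I,X,\alpha)$ with $I,X\in\mathsf{B}$ and $\alpha\in\mathsf{E}_{I\times X}$; a morphism $(I,X,\alpha)\to(J,Y,\beta)$ is a triple $(f_0,f_1,\phi)$ with $f_0:I\to J$, $f_1:I\times X\to Y$ in $\mathsf{B}$ and $\phi:\alpha\to\langle f_0\pi_I,f_1\rangle^*\beta$ in $\mathsf{E}_{I\times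 X}$, with the evident composition. It is fibred over $\mathsf{B}$ by the first component, with reindexing $f^*(J,Y,\beta)=(I,Y,\langle f\pi_I,\pi_Y\rangle^*\beta)$ for $f:I\to J$. It has simple coproducts, given by $\coprod_{\pi_J}(J\times K,Y,\beta)=(J,K\times Y,\beta)$. $\coprod$-quantifier-free. In a fibration $q:\mathsf{D}\to\mathsf{B}$ with simple coproducts, $\alpha\in\mathsf{D}_I$ is $\coprod$-quantifier-free if for every $f:A\to I$, every projection $\pi_A:A\times B\to A$, every $\beta\in\mathsf{D}_{A\times B}$ and every vertical arrow $h:f^*\alpha\to\coprod_{\pi_A}\beta$ of $\mathsf{D}_A$, there exist a unique $g:A\to B$ in $\mathsf{B}$ and a unique vertical arrow $\overline h:f^*\alpha\to\langle 1_A,g\rangle^*\beta$ such that $h=(\langle 1_A,g\rangle^*\eta_\beta)\,\overline h$, where $\eta_\beta:\beta\to\pi_A^*\coprod_{\pi_A}\beta$ is the unit of $\coprod_{\pi_A}\dashv\pi_A^*$. *)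

(* Defs.v *)
From Stdlib Require Import ssreflect ProofIrrelevance.

Set Implicit Arguments.
Unset Strict Implicit.
Unset Printing Implicit Defensive.

Record Category := {
  ob :> Type;
  hom : ob -> ob -> Type;
  id : forall x, hom x x;
  comp : forall x y z, hom y z -> hom x y -> hom x z;
  comp_id_l : forall x y (f : hom x y), comp (id y) f = f;
  comp_id_r : forall x y (f : hom x y), comp f (id x) = f;
  comp_assoc : forall x y z t (h : hom z t) (g : hom y z) (f : hom x y),
    comp h (comp g f) = comp (comp h g) f
}.

Arguments hom {c} x y.
Arguments id {c} x.
Arguments comp {c x y z} g f.
Arguments comp_assoc {c x y z t} h g f.

Declare Scope cat_scope.
Open Scope cat_scope.
Notation "g ∘ f" := (comp g f) (at level 40, left associativity) : cat_scope.

Definition is_iso (C : Category) (x y : C) (f : hom x y) : Prop :=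
  exists g : hom y x, g ∘ f = id x /\ f ∘ g = id y.

(** The identity arrow, seen as an arrow between two objects that are only
    propositionally equal; strict equalities of objects are used through it. *)
Definition eqarrow (C : Category) (x y : C) (e : x = y) : hom x y :=
  match e in _ = z return hom x z with eq_refl => id x end.

Record Functor (C D : Category) := {
  fob :> C -> D;
  fmap : forall x y, hom x y -> hom (fob x) (fob y);
  fmap_id : forall x, fmap (id x) = id (fob x);
  fmap_comp : forall x y z (g : hom y z) (f : hom x y),
    fmap (g ∘ f) = fmap g ∘ fmap f
}.

Arguments fmap {C D} F {x y} f : rename.

Record Adjunction (C D : Category) (L : Functor C D) (R : Functor D C) := {
  unit : forall c, hom c (R (L c));
  counit : forall d, hom (L (R d)) d;
  unit_natural : forall c c' (f : hom c c'),
    unit c' ∘ f = fmap R (fmap L f) ∘ unit c;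
  counit_natural : forall d d' (f : hom d d'),
    counit d' ∘ fmap L (fmap R f) = f ∘ counit d;
  triangle_L : forall c, counit (L c) ∘ fmap L (unit c) = id (L c);
  triangle_R : forall d, fmap R (counit d) ∘ unit (R d) = id (R d)
}.

Arguments unit {C D L R} a c : rename.
Arguments counit {C D L R} a d : rename.

Record CartesianCategory := {
  cat :> Category;
  one : cat;
  bang : forall x : cat, hom x one;
  bang_unique : forall (x : cat) (f : hom x one), f = bang x;
  prod : cat -> cat -> cat;
  pr1 : forall x y, hom (prod x y) x;
  pr2 : forall x y, hom (prod x y) y;
  pair : forall z x y, hom z x -> hom z y -> hom z (prod x y);
  pr1_pair : forall z x y (f : hom z x) (g : hom z y),
    pr1 x y ∘ pair f g = f;
  pr2_pair : forall z x y (f : hom z x) (g : hom z y),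
    pr2 x y ∘ pair f g = g;
  pair_unique : forall z x y (h : hom z (prod x y)),
    h = pair (pr1 x y ∘ h) (pr2 x y ∘ h)
}.

Arguments one {c}.
Arguments bang {c} x.
Arguments prod {c} x y.
Arguments pr1 {c} x y.
Arguments pr2 {c} x y.
Arguments pair {c z x y} f g.
Notation "x × y" := (prod x y) (at level 40, left associativity) : cat_scope.
Notation "⟨ f , g ⟩" := (pair f g) (at level 0, f, g at level 99) : cat_scope.

Lemma eqarrow_refl (C : Category) (x : C) (e : x = x) : eqarrow e = id x.
Proof. by rewrite (proof_irrelevance _ e eq_refl). Qed.

Lemma eqarrow_comp (C : Category) (x y z : C) (e : x = y) (e' : y = z) :
  eqarrow e' ∘ eqarrow e = eqarrow (eq_trans e e').
Proof. case: _ / e'; exact: comp_id_l. Qed.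

Lemma eqarrow_iso (C : Category) (x y : C) (e : x = y) : is_iso (eqarrow e).
Proof.
exists (eqarrow (eq_sym e)); rewrite !eqarrow_comp; split; exact: eqarrow_refl.
Qed.

Lemma adjunction_transpose (C D : Category) (L : Functor C D) (R : Functor D C)
    (adj : Adjunction L R) (c : C) (d : D) (g : hom c (R d)) :
  fmap R (counit adj d ∘ fmap L g) ∘ unit adj c = g.
Proof.
by rewrite fmap_comp -comp_assoc -unit_natural comp_assoc triangle_R comp_id_l.
Qed.

Section Cartesian.
Variable B : CartesianCategory.

Lemma pair_ext (z x y : B) (h k : hom z (x × y)) :
  pr1 x y ∘ h = pr1 x y ∘ k -> pr2 x y ∘ h = pr2 x y ∘ k -> h = k.
Proof. by move=> e1 e2; rewrite (pair_unique h) (pair_unique k) e1 e2. Qed.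

Lemma pair_comp (w z x y : B) (f : hom z x) (g : hom z y) (h : hom w z) :
  ⟨f, g⟩ ∘ h = ⟨f ∘ h, g ∘ h⟩.
Proof.
by apply: pair_ext; rewrite comp_assoc !(pr1_pair, pr2_pair).
Qed.

Lemma pair_pr (x y : B) : ⟨pr1 x y, pr2 x y⟩ = id (x × y).
Proof. by rewrite [RHS]pair_unique !comp_id_r. Qed.

End Cartesian.

Section UniversalArrows.
Variables (C D : Category) (R : Functor D C) (L : C -> D).
Variable eta : forall c, hom c (R (L c)).
Variable transpose : forall c d (f : hom c (R d)),
  {k : hom (L c) d | fmap R k ∘ eta c = f /\
                     forall k', fmap R k' ∘ eta c = f -> k' = k}.

Let tr c d (f : hom c (R d)) : hom (L c) d := proj1_sig (transpose f).

Let tr_eta c d (f : hom c (R d)) : fmap R (tr f) ∘ eta c = f.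
Proof. exact: (proj1 (proj2_sig (transpose f))). Qed.

Let tr_uniq c d (k k' : hom (L c) d) :
  fmap R k ∘ eta c = fmap R k' ∘ eta c -> k = k'.
Proof.
move=> e; rewrite (proj2 (proj2_sig (transpose _)) _ e).
by rewrite -(proj2 (proj2_sig (transpose _)) _ (eq_refl _)).
Qed.

Definition universal_functor : Functor C D.
Proof.
refine {| fob := L; fmap := fun c c' f => tr (eta c' ∘ f) |}.
- by move=> c; apply: tr_uniq; rewrite tr_eta fmap_id comp_id_l comp_id_r.
- move=> c c' c'' g f; apply: tr_uniq.
  by rewrite tr_eta fmap_comp -comp_assoc tr_eta !comp_assoc tr_eta.
Defined.

Definition universal_adjunction : Adjunction universal_functor R.
Proof.
refine {| unit := eta : forall c, hom c (R (universal_functor c));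
          counit := fun d =>
            tr (id (R d)) : hom (universal_functor (R d)) d |}.
- by move=> c c' f /=; rewrite tr_eta.
- move=> d d' f /=; apply: tr_uniq.
  by rewrite !fmap_comp -!comp_assoc !tr_eta comp_assoc tr_eta comp_id_l comp_id_r.
- move=> c /=; apply: tr_uniq.
  by rewrite fmap_comp -comp_assoc tr_eta comp_assoc tr_eta fmap_id comp_id_l.
- by move=> d /=; rewrite tr_eta.
Defined.

End UniversalArrows.

Section Fibres.
Variables (E B : Category) (p : Functor E B).

Record fibre_ob (I : B) := FibreOb { carrier :> E; carrier_over : p carrier = I }.

(** [f] is above [u], modulo the equalities [p x = I] and [p y = J]. *)
Definition lies_over (I J : B) (u : hom I J) (x : fibre_ob I) (y : fibre_ob J)
    (f : hom x y) : Prop :=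
  eqarrow (carrier_over y) ∘ fmap p f = u ∘ eqarrow (carrier_over x).

Record vertical (I : B) (x y : fibre_ob I) :=
  Vertical { arrow :> hom x y; arrow_over : lies_over (id I) arrow }.

Lemma vertical_ext (I : B) (x y : fibre_ob I) (f g : vertical x y) :
  arrow f = arrow g -> f = g.
Proof.
case: f g => [f hf] [g hg] /= e; case: _ / e hg => hg.
by rewrite (proof_irrelevance _ hf hg).
Qed.

Lemma over_id (I : B) (x : fibre_ob I) : lies_over (id I) (id (carrier x)).
Proof. by rewrite /lies_over fmap_id comp_id_l comp_id_r. Qed.

Lemma over_comp (I J K : B) (v : hom J K) (u : hom I J)
    (x : fibre_ob I) (y : fibre_ob J) (z : fibre_ob K)
    (g : hom y z) (f : hom x y) :
  lies_over v g -> lies_over u f -> lies_over (v ∘ u) (g ∘ f).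
Proof.
rewrite /lies_over fmap_comp comp_assoc => -> e.
by rewrite -!comp_assoc e.
Qed.

Definition vertical_id (I : B) (x : fibre_ob I) : vertical x x :=
  Vertical (over_id x).

Lemma vertical_comp_over (I : B) (x y z : fibre_ob I)
    (g : vertical y z) (f : vertical x y) : lies_over (id I) (arrow g ∘ arrow f).
Proof.
rewrite -(comp_id_l (id I)); apply: over_comp; exact: arrow_over.
Qed.

Definition vertical_comp (I : B) (x y z : fibre_ob I)
    (g : vertical y z) (f : vertical x y) : vertical x z :=
  Vertical (vertical_comp_over g f).

Definition Fibre (I : B) : Category.
Proof.
refine {| ob := fibre_ob I; hom := @vertical I;
          id := @vertical_id I; comp := @vertical_comp I |}.
- by move=> x y f; apply: vertical_ext; exact: comp_id_l.
- by move=> x y f; apply: vertical_ext; exact: comp_id_r.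
- by move=> x y z t h g f; apply: vertical_ext; exact: comp_assoc.
Defined.

Lemma arrow_comp (I : B) (x y z : Fibre I) (g : hom y z) (f : hom x y) :
  arrow (g ∘ f) = arrow g ∘ arrow f.
Proof. by []. Qed.

Lemma arrow_eqarrow (I : B) (x y : Fibre I) (e : x = y) :
  arrow (eqarrow e) = eqarrow (f_equal (@carrier I) e).
Proof. by case: _ / e. Qed.

End Fibres.

Arguments lies_over {E B} p {I J} u {x y} f.

(** A functor with a chosen cartesian lifting [lift u y : u^* y -> y] for each
    [u : I -> J] and each [y] over [J], the choice being strictly functorial.
    The fields from [factor] to [factor_unique] say that [lift u y] is
    cartesian. *)
Record SplitFibration (B : Category) := {
  total : Category;
  proj : Functor total B;
  reindex : forall (I J : B) (u : hom I J), Fibre proj J -> Fibre proj I;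
  lift : forall (I J : B) (u : hom I J) (y : Fibre proj J),
    hom (carrier (reindex u y)) (carrier y);
  lift_over : forall (I J : B) (u : hom I J) (y : Fibre proj J),
    lies_over proj u (lift u y);
  factor : forall (I J K : B) (u : hom I J) (w : hom K I)
      (y : Fibre proj J) (z : Fibre proj K) (g : hom (carrier z) (carrier y)),
    lies_over proj (u ∘ w) g -> hom (carrier z) (carrier (reindex u y));
  factor_over : forall (I J K : B) (u : hom I J) (w : hom K I)
      (y : Fibre proj J) (z : Fibre proj K) (g : hom (carrier z) (carrier y))
      (o : lies_over proj (u ∘ w) g),
    lies_over proj w (factor o);
  factor_comm : forall (I J K : B) (u : hom I J) (w : hom K I)
      (y : Fibre proj J) (z : Fibre proj K) (g : hom (carrier z) (carrier y))
      (o : lies_over proj (u ∘ w) g),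
    lift u y ∘ factor o = g;
  factor_unique : forall (I J K : B) (u : hom I J) (w : hom K I)
      (y : Fibre proj J) (z : Fibre proj K) (g : hom (carrier z) (carrier y))
      (o : lies_over proj (u ∘ w) g)
      (k : hom (carrier z) (carrier (reindex u y))),
    lies_over proj w k -> lift u y ∘ k = g -> k = factor o;
  reindex_id : forall (J : B) (y : Fibre proj J), reindex (id J) y = y;
  lift_id : forall (J : B) (y : Fibre proj J),
    lift (id J) y = eqarrow (f_equal (@carrier _ _ _ _) (reindex_id y));
  reindex_comp : forall (I J K : B) (v : hom J K) (u : hom I J)
      (z : Fibre proj K),
    reindex (v ∘ u) z = reindex u (reindex v z);
  lift_comp : forall (I J K : B) (v : hom J K) (u : hom I J)
      (z : Fibre proj K),
    lift (v ∘ u) z = lift v z ∘ lift u (reindex v z)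
                     ∘ eqarrow (f_equal (@carrier _ _ _ _) (reindex_comp v u z))
}.

Arguments reindex {B} p {I J} u y : rename.
Arguments lift {B} p {I J} u y : rename.
Arguments lift_over {B} p {I J} u y : rename.
Arguments factor {B p I J K u w y z g} o : rename.

(** The fibre category over [I], written [E_I] for a fibration with total
    category [E]. *)
Notation "p @[ I ]" := (Fibre (proj p) I) (at level 9, format "p @[ I ]")
  : cat_scope.

Section SplitFibrationTheory.
Variables (B : Category) (p : SplitFibration B).

Lemma over_eq (I J : B) (u v : hom I J) (x : p@[I]) (y : p@[J])
    (f : hom (carrier x) (carrier y)) :
  u = v -> lies_over (proj p) u f -> lies_over (proj p) v f.
Proof. by move=> ->. Qed.

Lemma lift_mono (I J K : B) (u : hom I J) (w : hom K I) (y : p@[J]) (z : p@[K])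
    (k k' : hom (carrier z) (carrier (reindex p u y))) :
  lies_over (proj p) w k -> lies_over (proj p) w k' ->
  lift p u y ∘ k = lift p u y ∘ k' -> k = k'.
Proof.
move=> o o' e; have ol := over_comp (lift_over p u y) o'.
by rewrite (factor_unique ol o e) -(factor_unique ol o' (eq_refl _)).
Qed.

Lemma vertical_over_comp (I J : B) (u : hom I J) (x : p@[I]) (y z : p@[J])
    (f : hom y z) (g : hom (carrier x) (carrier y)) :
  lies_over (proj p) u g -> lies_over (proj p) u (arrow f ∘ g).
Proof.
move=> o; apply: over_eq (over_comp (arrow_over f) o); exact: comp_id_l.
Qed.

Lemma over_vertical_comp (I J : B) (u : hom I J) (x y : p@[I]) (z : p@[J])
    (f : hom (carrier y) (carrier z)) (g : hom x y) :
  lies_over (proj p) u f -> lies_over (proj p) u (f ∘ arrow g).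
Proof.
move=> o; apply: over_eq (over_comp o (arrow_over g)); exact: comp_id_r.
Qed.

Lemma vfactor_over (I J : B) (u : hom I J) (x : p@[I]) (y : p@[J])
    (g : hom (carrier x) (carrier y)) :
  lies_over (proj p) u g -> lies_over (proj p) (u ∘ id I) g.
Proof. by rewrite comp_id_r. Qed.

(** The vertical arrow [x -> u^* y] determined by an arrow over [u]. *)
Definition vfactor (I J : B) (u : hom I J) (x : p@[I]) (y : p@[J])
    (g : hom (carrier x) (carrier y)) (o : lies_over (proj p) u g) :
    @hom p@[I] x (reindex p u y) :=
  @Vertical _ _ _ _ x (reindex p u y) (factor (vfactor_over o))
    (factor_over (vfactor_over o)).

Lemma vfactorK (I J : B) (u : hom I J) (x : p@[I]) (y : p@[J])
    (g : hom (carrier x) (carrier y)) (o : lies_over (proj p) u g) :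
  lift p u y ∘ arrow (vfactor o) = g.
Proof. exact: factor_comm. Qed.

Lemma vlift_mono (I J : B) (u : hom I J) (x : p@[I]) (y : p@[J])
    (k k' : hom x (reindex p u y)) :
  lift p u y ∘ arrow k = lift p u y ∘ arrow k' -> k = k'.
Proof.
move=> e; apply: vertical_ext; apply: lift_mono e; exact: arrow_over.
Qed.

Definition reindex_map (I J : B) (u : hom I J) (x y : p@[J]) (f : hom x y) :
    hom (reindex p u x) (reindex p u y) :=
  vfactor (vertical_over_comp f (lift_over p u x)).

Lemma reindex_mapK (I J : B) (u : hom I J) (x y : p@[J]) (f : hom x y) :
  lift p u y ∘ arrow (reindex_map u f) = arrow f ∘ lift p u x.
Proof. exact: vfactorK. Qed.

Definition reindexing (I J : B) (u : hom I J) : Functor p@[J] p@[I].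
Proof.
refine {| fob := reindex p u; fmap := @reindex_map I J u |}.
- move=> x; apply: vlift_mono; rewrite reindex_mapK /=.
  by rewrite comp_id_l comp_id_r.
- move=> x y z g f; apply: vlift_mono; rewrite reindex_mapK /=.
  by rewrite comp_assoc reindex_mapK -!comp_assoc reindex_mapK.
Defined.

Lemma reindex_unit (I : B) (u : hom I I) (y : p@[I]) :
  u = id I -> y = reindex p u y.
Proof. by move=> ->; rewrite reindex_id. Qed.

Lemma reindex_fuse (I J K : B) (v : hom J K) (u : hom I J) (w : hom I K)
    (z : p@[K]) : v ∘ u = w -> reindex p u (reindex p v z) = reindex p w z.
Proof. by move=> <-; rewrite reindex_comp. Qed.

Lemma reindex_square (I J J' K : B) (v : hom J K) (u : hom I J)
    (v' : hom J' K) (u' : hom I J') (z : p@[K]) :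
  v ∘ u = v' ∘ u' ->
  reindex p u (reindex p v z) = reindex p u' (reindex p v' z).
Proof. by rewrite -!reindex_comp => ->. Qed.

Lemma lift_id_eq (I : B) (u : hom I I) (y : p@[I]) (h : reindex p u y = y) :
  u = id I -> lift p u y = eqarrow (f_equal (@carrier _ _ _ _) h).
Proof.
by move=> hu; subst u; rewrite lift_id (proof_irrelevance _ h (reindex_id y)).
Qed.

Lemma lift_comp_eq (I J K : B) (v : hom J K) (u : hom I J) (w : hom I K)
    (z : p@[K]) (h : reindex p w z = reindex p u (reindex p v z)) :
  v ∘ u = w ->
  lift p w z = lift p v z ∘ lift p u (reindex p v z)
               ∘ eqarrow (f_equal (@carrier _ _ _ _) h).
Proof.
by move=> hw; subst w; rewrite lift_comp (proof_irrelevance _ h (reindex_comp v u z)).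
Qed.

Lemma lift_unit (I : B) (u : hom I I) (y : p@[I]) (e : y = reindex p u y) :
  u = id I -> lift p u y ∘ arrow (eqarrow e) = id (carrier y).
Proof.
move=> hu; subst u; rewrite lift_id arrow_eqarrow eqarrow_comp; exact: eqarrow_refl.
Qed.

Lemma lift_fuse (I J K : B) (v : hom J K) (u : hom I J) (w : hom I K)
    (z : p@[K]) (e : reindex p u (reindex p v z) = reindex p w z) :
  v ∘ u = w ->
  lift p w z ∘ arrow (eqarrow e) = lift p v z ∘ lift p u (reindex p v z).
Proof.
move=> h; subst w; rewrite lift_comp arrow_eqarrow -!comp_assoc eqarrow_comp.
by rewrite eqarrow_refl comp_id_r.
Qed.

Lemma lift_subst (I J : B) (u : hom I J) (x y : p@[J]) (e : x = y) :
  arrow (eqarrow e) ∘ lift p u x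
  = lift p u y ∘ eqarrow (f_equal (fun z => carrier (reindex p u z)) e).
Proof. by case: _ / e; rewrite /= comp_id_l comp_id_r. Qed.

Lemma lift3_id (I J K : B) (v : hom J K) (u : hom I J) (t : hom K I) (y : p@[K])
    (e : y = reindex p t (reindex p u (reindex p v y))) :
  v ∘ u ∘ t = id K ->
  lift p v y ∘ (lift p u _ ∘ (lift p t _ ∘ arrow (eqarrow e))) = id (carrier y).
Proof.
move=> h; have e1 := reindex_fuse y (eq_refl (v ∘ u)).
rewrite comp_assoc -(lift_fuse e1 (eq_refl _)) -comp_assoc.
rewrite [arrow (eqarrow e1) ∘ _]comp_assoc lift_subst.
have e2 := reindex_fuse y (eq_refl (v ∘ u ∘ t)).
rewrite !comp_assoc -(lift_fuse e2 (eq_refl _)).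
have e3 : reindex p (v ∘ u ∘ t) y = y by rewrite h reindex_id.
rewrite (lift_id_eq e3 h) !arrow_eqarrow !eqarrow_comp; exact: eqarrow_refl.
Qed.

Lemma lift_square (I J J' K : B) (v : hom J K) (u : hom I J)
    (v' : hom J' K) (u' : hom I J') (z : p@[K])
    (e : reindex p u (reindex p v z) = reindex p u' (reindex p v' z)) :
  v ∘ u = v' ∘ u' ->
  lift p v' z ∘ (lift p u' (reindex p v' z) ∘ arrow (eqarrow e))
  = lift p v z ∘ lift p u (reindex p v z).
Proof.
move=> h; have e1 := reindex_fuse z h; have e2 := reindex_fuse z (eq_refl (v' ∘ u')).
rewrite -(lift_fuse e1 h) comp_assoc -(lift_fuse e2 (eq_refl _)).
rewrite -comp_assoc !arrow_eqarrow eqarrow_comp.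
by congr (_ ∘ eqarrow _); exact: proof_irrelevance.
Qed.

Lemma lift_square_map (I J J' K : B) (v : hom J K) (u : hom I J)
    (v' : hom J' K) (u' : hom I J') (z : p@[K]) (x : p@[J])
    (e : reindex p u (reindex p v z) = reindex p u' (reindex p v' z))
    (k : hom x (reindex p v z)) :
  v ∘ u = v' ∘ u' ->
  lift p v' z ∘ (lift p u' (reindex p v' z)
                 ∘ arrow (eqarrow e ∘ fmap (reindexing u) k))
  = lift p v z ∘ (arrow k ∘ lift p u x).
Proof.
move=> h; rewrite arrow_comp -(reindex_mapK u k).
by rewrite (comp_assoc _ _ (arrow (reindex_map u k))) -(lift_square e h) !comp_assoc.
Qed.

End SplitFibrationTheory.

Arguments reindexing {B} p {I J} u.

Section SimpleCoproducts.
Variables (B : CartesianCategory) (q : SplitFibration B).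

Definition prod_map_id (I J X : B) (f : hom I J) : hom (I × X) (J × X) :=
  ⟨f ∘ pr1 I X, pr2 I X⟩.

Lemma pr1_prod_map_id (I J X : B) (f : hom I J) :
  pr1 J X ∘ prod_map_id X f = f ∘ pr1 I X.
Proof. exact: pr1_pair. Qed.

(** The canonical map [∐ (f × 1)^* β -> f^* ∐ β]: the transpose of [(f × 1)^*]
    applied to the unit at [β]. *)
Definition coprod_comparison
    (coprod : forall I X : B, Functor q@[I × X] q@[I])
    (adj : forall I X : B, Adjunction (coprod I X) (reindexing q (pr1 I X)))
    (I J X : B) (f : hom I J) (b : q@[J × X]) :
    hom (coprod I X (reindexing q (prod_map_id X f) b))
        (reindexing q f (coprod J X b)) :=
  counit (adj I X) (reindexing q f (coprod J X b))
  ∘ fmap (coprod I X)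
      (eqarrow (reindex_square (coprod J X b) (pr1_prod_map_id X f))
       ∘ fmap (reindexing q (prod_map_id X f)) (unit (adj J X) b)).

Record SimpleCoproducts := {
  coprod : forall I X : B, Functor q@[I × X] q@[I];
  coprod_adj : forall I X : B,
    Adjunction (coprod I X) (reindexing q (pr1 I X));
  beck_chevalley : forall (I J X : B) (f : hom I J) (b : q@[J × X]),
    is_iso (coprod_comparison coprod_adj f b)
}.

Lemma reindex_section (A X : B) (g : hom A X) (c : q@[A]) :
  reindex q ⟨id A, g⟩ (reindex q (pr1 A X) c) = c.
Proof. by rewrite -reindex_comp pr1_pair reindex_id. Qed.

(** [⟨1, g⟩^* η : ⟨1, g⟩^* β -> ⟨1, g⟩^* π^* ∐ β = ∐ β] *)
Definition section_unit (S : SimpleCoproducts) (A X : B) (g : hom A X)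
    (b : q@[A × X]) : hom (reindexing q ⟨id A, g⟩ b) (coprod S A X b) :=
  eqarrow (reindex_section g (coprod S A X b))
  ∘ fmap (reindexing q ⟨id A, g⟩) (unit (coprod_adj S A X) b).

Definition quantifier_free (S : SimpleCoproducts) (I : B) (a : q@[I]) : Prop :=
  forall (A : B) (f : hom A I) (X : B) (b : q@[A × X])
         (h : hom (reindexing q f a) (coprod S A X b)),
  exists! gk : {g : hom A X & hom (reindexing q f a) (reindexing q ⟨id A, g⟩ b)},
    h = section_unit S (projT1 gk) b ∘ projT2 gk.

End SimpleCoproducts.

Section Sum.
Variables (B : CartesianCategory) (p : SplitFibration B).

Record sum_ob := SumOb {
  base : B;
  arity : B;
  family : p@[base × arity]
}.

Definition sum_base (s t : sum_ob) (f0 : hom (base s) (base t))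
    (f1 : hom (base s × arity s) (arity t)) :
    hom (base s × arity s) (base t × arity t) :=
  ⟨f0 ∘ pr1 (base s) (arity s), f1⟩.

Record sum_hom (s t : sum_ob) := SumHom {
  hom0 : hom (base s) (base t);
  hom1 : hom (base s × arity s) (arity t);
  homf : hom (family s) (reindex p (sum_base hom0 hom1) (family t))
}.

Definition hom01 (s t : sum_ob) (f : sum_hom s t) := sum_base (hom0 f) (hom1 f).

(** The arrow of the total category of [p] represented by the third component. *)
Definition homt (s t : sum_ob) (f : sum_hom s t) :
    hom (carrier (family s)) (carrier (family t)) :=
  lift p (hom01 f) (family t) ∘ arrow (homf f).

Lemma homt_over (s t : sum_ob) (f : sum_hom s t) :
  lies_over (proj p) (hom01 f) (homt f).
Proof. apply: over_vertical_comp; exact: lift_over. Qed.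

Lemma sum_hom_ext (s t : sum_ob) (f g : sum_hom s t) :
  hom0 f = hom0 g -> hom1 f = hom1 g -> homt f = homt g -> f = g.
Proof.
case: f g => [f0 f1 ff] [g0 g1 gf] /= e0 e1; subst g0 g1.
by move=> /vlift_mono /= ->.
Qed.

Lemma sum_base_id (s : sum_ob) :
  sum_base (id (base s)) (pr2 (base s) (arity s)) = id (base s × arity s).
Proof. by rewrite /sum_base comp_id_l pair_pr. Qed.

Definition sum_id (s : sum_ob) : sum_hom s s :=
  SumHom (eqarrow (reindex_unit (family s) (sum_base_id s))).

Lemma sum_base_comp (s t r : sum_ob) (g : sum_hom t r) (f : sum_hom s t) :
  hom01 g ∘ hom01 f = sum_base (hom0 g ∘ hom0 f) (hom1 g ∘ hom01 f).
Proof. by rewrite {1}/hom01 {1}/sum_base pair_comp -comp_assoc pr1_pair comp_assoc. Qed.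

Definition sum_comp (s t r : sum_ob) (g : sum_hom t r) (f : sum_hom s t) :
    sum_hom s r :=
  SumHom (eqarrow (reindex_fuse (family r) (sum_base_comp g f))
          ∘ (fmap (reindexing p (hom01 f)) (homf g) ∘ homf f)).

Lemma homt_id (s : sum_ob) : homt (sum_id s) = id (carrier (family s)).
Proof. by rewrite /homt lift_unit //; exact: sum_base_id. Qed.

Lemma homt_comp (s t r : sum_ob) (g : sum_hom t r) (f : sum_hom s t) :
  homt (sum_comp g f) = homt g ∘ homt f.
Proof.
rewrite /homt [homf _]/= !arrow_comp [LHS]comp_assoc.
rewrite (lift_fuse _ (sum_base_comp g f)).
by rewrite -!comp_assoc [lift p (hom01 f) _ ∘ _]comp_assoc reindex_mapK !comp_assoc.
Qed.

Definition SumTotal : Category.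
Proof.
refine {| ob := sum_ob; hom := sum_hom; id := sum_id; comp := sum_comp |}.
- move=> s t f; apply: sum_hom_ext => /=; first exact: comp_id_l.
    exact: pr2_pair.
  by rewrite homt_comp homt_id comp_id_l.
- move=> s t f; apply: sum_hom_ext => /=; first exact: comp_id_r.
    by rewrite /hom01 sum_base_id comp_id_r.
  by rewrite homt_comp homt_id comp_id_r.
- move=> s t r w h g f; apply: sum_hom_ext => /=; first exact: comp_assoc.
    by rewrite -comp_assoc sum_base_comp.
  by rewrite !homt_comp comp_assoc.
Defined.

Definition SumProj : Functor SumTotal B :=
  @Build_Functor SumTotal B base hom0
    (fun _ => eq_refl) (fun _ _ _ _ _ => eq_refl).

Lemma hom0_eqarrow (s t : SumTotal) (e : s = t) :
  hom0 (eqarrow e) = eqarrow (f_equal base e).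
Proof. by case: _ / e. Qed.

(** The arrow with given components, the third one in the form of [homt]. *)
Definition mk_sum_hom (s t : sum_ob) (f0 : hom (base s) (base t))
    (f1 : hom (base s × arity s) (arity t))
    (g : hom (carrier (family s)) (carrier (family t)))
    (o : lies_over (proj p) (sum_base f0 f1) g) : sum_hom s t :=
  SumHom (vfactor o).

Lemma homt_mk (s t : sum_ob) (f0 : hom (base s) (base t))
    (f1 : hom (base s × arity s) (arity t))
    (g : hom (carrier (family s)) (carrier (family t)))
    (o : lies_over (proj p) (sum_base f0 f1) g) : homt (mk_sum_hom o) = g.
Proof. exact: vfactorK. Qed.

(** Every object of the fibre over [I] is [(I, X, a)] for some [X] and [a],
    but its first component is only propositionally equal to [I]; [sum_fib_rect]
    gets rid of this equality. *)
Definition sum_fib (I X : B) (a : p@[I × X]) : Fibre SumProj I :=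
  @FibreOb SumTotal B SumProj I (SumOb a) eq_refl.

Definition sum_fib_rect (I : B) (P : Fibre SumProj I -> Type)
    (H : forall (X : B) (a : p@[I × X]), P (sum_fib a))
    (t : Fibre SumProj I) : P t :=
  match t with
  | @FibreOb _ _ _ _ s e =>
    match e as e' in _ = K return
      forall P : Fibre SumProj K -> Type,
        (forall (X : B) (a : p@[K × X]), P (sum_fib a)) ->
        P (@FibreOb SumTotal B SumProj K s e')
    with eq_refl =>
      match s as s' return
        forall P : Fibre SumProj (base s') -> Type,
          (forall (X : B) (a : p@[base s' × X]), P (sum_fib a)) ->
          P (@FibreOb SumTotal B SumProj (base s') s' eq_refl)
      with @SumOb _ _ a => fun P H => H _ a end
    end P H
  end.

(** The third component of an object of the fibre over [I]. *)
Definition fam (I : B) (t : Fibre SumProj I) : p@[I × arity (carrier t)] :=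
  sum_fib_rect (P := fun t => p@[I × arity (carrier t)]) (fun X a => a) t.

Lemma sum_over (I J X Y : B) (a : p@[I × X]) (b : p@[J × Y]) (u : hom I J)
    (f : sum_hom (SumOb a) (SumOb b)) :
  @lies_over _ _ SumProj _ _ u (sum_fib a) (sum_fib b) f <-> hom0 f = u.
Proof. by rewrite /lies_over /= comp_id_l comp_id_r. Qed.

Lemma sum_eqarrow (I X : B) (a b : p@[I × X]) (h : a = b)
    (e : SumOb a = SumOb b :> SumTotal) :
  hom0 (eqarrow e) = id I /\ hom1 (eqarrow e) = pr2 I X /\
  homt (eqarrow e) = eqarrow (f_equal (@carrier _ _ _ _) h).
Proof.
by subst b; rewrite eqarrow_refl /= homt_id.
Qed.

Definition sum_reindex (I J : B) (u : hom I J) (t : Fibre SumProj J) :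
    Fibre SumProj I :=
  sum_fib (reindex p (prod_map_id (arity (carrier t)) u) (fam t)).

Definition sum_lift (I J : B) (u : hom I J) (t : Fibre SumProj J) :
    @hom SumTotal (carrier (sum_reindex u t)) (carrier t) :=
  sum_fib_rect (P := fun t => @hom SumTotal (carrier (sum_reindex u t)) (carrier t))
    (fun X a => @SumHom (SumOb (reindex p (prod_map_id X u) a)) (SumOb a)
                  u (pr2 I X) (id (reindex p (prod_map_id X u) a)))
    t.

Lemma homt_lift (I J X : B) (u : hom I J) (a : p@[J × X]) :
  homt (sum_lift u (sum_fib a)) = lift p (prod_map_id X u) a.
Proof. by rewrite /homt /= comp_id_r. Qed.

Lemma sum_lift_over (I J : B) (u : hom I J) (t : Fibre SumProj J) :
  lies_over SumProj u (sum_lift u t).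
Proof. by elim/sum_fib_rect: t => X a; apply/sum_over. Qed.

Lemma sum_factor_over (I J X : B) (u : hom I J) (a : p@[J × X])
    (s : sum_ob) (g : sum_hom s (SumOb a)) (w : hom (base s) I) :
  hom0 g = u ∘ w ->
  lies_over (proj p) (prod_map_id X u ∘ ⟨w ∘ pr1 _ _, hom1 g⟩) (homt g).
Proof.
move=> e; apply: over_eq (homt_over g).
by rewrite /hom01 /sum_base /= e pair_comp pr2_pair -!comp_assoc pr1_pair.
Qed.

Definition sum_factor (I J K : B) (u : hom I J) (w : hom K I)
    (y : Fibre SumProj J) (z : Fibre SumProj K)
    (g : @hom SumTotal (carrier z) (carrier y)) :
  lies_over SumProj (u ∘ w) g ->
  @hom SumTotal (carrier z) (carrier (sum_reindex u y)).
Proof.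
elim/sum_fib_rect: y g => X a; elim/sum_fib_rect: z => Z c g /sum_over o.
exact: (@mk_sum_hom (SumOb c) (SumOb (reindex p (prod_map_id X u) a)) w (hom1 g)
          _ (factor_over (sum_factor_over o))).
Defined.

Lemma prod_map_id_id (I X : B) : prod_map_id X (id I) = id (I × X).
Proof. by rewrite /prod_map_id comp_id_l pair_pr. Qed.

Lemma prod_map_id_comp (I J K X : B) (v : hom J K) (u : hom I J) :
  prod_map_id X v ∘ prod_map_id X u = prod_map_id X (v ∘ u).
Proof. by rewrite /prod_map_id pair_comp -comp_assoc pr1_pair pr2_pair comp_assoc. Qed.

Lemma sum_reindex_id (J : B) (t : Fibre SumProj J) : sum_reindex (id J) t = t.
Proof.
elim/sum_fib_rect: t => X a.
exact (f_equal (@sum_fib J X) (eq_sym (reindex_unit a (prod_map_id_id J X)))).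
Qed.

Lemma sum_reindex_comp (I J K : B) (v : hom J K) (u : hom I J)
    (t : Fibre SumProj K) :
  sum_reindex (v ∘ u) t = sum_reindex u (sum_reindex v t).
Proof.
elim/sum_fib_rect: t => X a.
exact (f_equal (@sum_fib I X) (eq_sym (reindex_fuse a (prod_map_id_comp X v u)))).
Qed.

Lemma hom1_comp (s t r : SumTotal) (g : hom t r) (f : hom s t) :
  hom1 (g ∘ f) = hom1 g ∘ hom01 f.
Proof. by []. Qed.

Definition SumFibration : SplitFibration B.
Proof.
refine (@Build_SplitFibration B SumTotal SumProj sum_reindex sum_lift sum_lift_over
          sum_factor _ _ _ sum_reindex_id _ sum_reindex_comp _).
- move=> I J K u w y z; elim/sum_fib_rect: y => X a; elim/sum_fib_rect: z => Z c g o.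
  exact/sum_over.
- move=> I J K u w y z; elim/sum_fib_rect: y => X a; elim/sum_fib_rect: z => Z c g o.
  have e : hom0 g = u ∘ w by exact/sum_over.
  apply: sum_hom_ext => /=; first by rewrite e.
    by rewrite pr2_pair.
  by rewrite homt_comp homt_lift homt_mk factor_comm.
- move=> I J K u w y z; elim/sum_fib_rect: y => X a; elim/sum_fib_rect: z => Z c g o k.
  move=> /sum_over e0 e.
  have e1 : hom1 k = hom1 g by rewrite -e /= pr2_pair.
  apply: sum_hom_ext => //; rewrite homt_mk.
  apply: factor_unique; first by rewrite -e0 -e1; exact: homt_over.
  by move: (f_equal (@homt _ _) e); rewrite homt_comp homt_lift.
- move=> J t; elim/sum_fib_rect: t => X a.
  have h := eq_sym (reindex_unit a (prod_map_id_id J X)).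
  have [e0 [e1 et]] := sum_eqarrow h (f_equal (@carrier _ _ SumProj _)
                                        (sum_reindex_id (sum_fib a))).
  apply: sum_hom_ext; [by rewrite e0 | by rewrite e1 |].
  rewrite homt_lift et; apply: lift_id_eq; exact: prod_map_id_id.
- move=> I J K v u t; elim/sum_fib_rect: t => X a.
  have h := eq_sym (reindex_fuse a (prod_map_id_comp X v u)).
  have [e0 [e1 et]] := sum_eqarrow h (f_equal (@carrier _ _ SumProj _)
                                        (sum_reindex_comp v u (sum_fib a))).
  apply: sum_hom_ext.
  + by rewrite [RHS]/= e0 /= comp_id_r.
  + rewrite hom1_comp /hom01 e0 e1 /=.
    by rewrite /sum_base /= comp_id_l pair_pr comp_id_r pr2_pair.
  + rewrite homt_lift 2!homt_comp et !homt_lift.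
    apply: lift_comp_eq; exact: prod_map_id_comp.
Defined.

Definition assoc (I X Y : B) : hom (I × X × Y) (I × (X × Y)) :=
  ⟨pr1 I X ∘ pr1 (I × X) Y, ⟨pr2 I X ∘ pr1 (I × X) Y, pr2 (I × X) Y⟩⟩.

Definition assoc_inv (I X Y : B) : hom (I × (X × Y)) (I × X × Y) :=
  ⟨⟨pr1 I (X × Y), pr1 X Y ∘ pr2 I (X × Y)⟩, pr2 X Y ∘ pr2 I (X × Y)⟩.

Lemma assoc_invK (I X Y : B) : assoc I X Y ∘ assoc_inv I X Y = id _.
Proof.
rewrite /assoc !pair_comp -!comp_assoc !pr1_pair !pr2_pair -pair_comp pair_pr.
by rewrite comp_id_l pair_pr.
Qed.

Lemma assocK (I X Y : B) : assoc_inv I X Y ∘ assoc I X Y = id _.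
Proof.
rewrite /assoc_inv !pair_comp -!comp_assoc !pr1_pair !pr2_pair pr1_pair.
by rewrite -pair_comp pair_pr comp_id_l pair_pr.
Qed.

(** [∐ (I × X, Y, a) = (I, X × Y, a)], where [a] over [(I × X) × Y] is moved
    along the associativity isomorphism. *)
Definition sum_coprod (I X : B) (t : Fibre SumProj (I × X)) : Fibre SumProj I :=
  sum_fib (reindex p (assoc_inv I X (arity (carrier t))) (fam t)).

Definition unit_arity (I X Y : B) : hom (I × X × Y) (X × Y) :=
  ⟨pr2 I X ∘ pr1 (I × X) Y, pr2 (I × X) Y⟩.

Lemma unit_base (I X Y : B) :
  prod_map_id (X × Y) (pr1 I X) ∘ ⟨id (I × X) ∘ pr1 (I × X) Y, unit_arity I X Y⟩
  = assoc I X Y.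
Proof.
by rewrite /prod_map_id pair_comp pr2_pair -comp_assoc pr1_pair comp_id_l.
Qed.

Lemma sum_unit_eq (I X Y : B) (a : p@[I × X × Y]) :
  a = reindex p ⟨id (I × X) ∘ pr1 (I × X) Y, unit_arity I X Y⟩
        (reindex p (prod_map_id (X × Y) (pr1 I X)) (reindex p (assoc_inv I X Y) a)).
Proof. by rewrite -!reindex_comp unit_base assocK reindex_id. Qed.

Definition sum_unit_hom (I X Y : B) (a : p@[I × X × Y]) :
    sum_hom (SumOb a) (carrier (sum_reindex (pr1 I X) (sum_coprod (sum_fib a)))) :=
  @SumHom (SumOb a) (carrier (sum_reindex (pr1 I X) (sum_coprod (sum_fib a))))
    (id (I × X)) (unit_arity I X Y) (eqarrow (sum_unit_eq a)).

Definition sum_unit (I X : B) (t : SumFibration@[I × X]) :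
    hom t (reindexing SumFibration (pr1 I X) (sum_coprod t)) :=
  sum_fib_rect
    (P := fun t => @hom SumFibration@[I × X] t
                     (reindexing SumFibration (pr1 I X) (sum_coprod t)))
    (fun Y a => @Vertical _ _ SumProj (I × X) (sum_fib a)
                  (sum_reindex (pr1 I X) (sum_coprod (sum_fib a)))
                  (sum_unit_hom a)
                  (proj2 (sum_over _ _) eq_refl))
    t.

(** The unit followed by the cartesian arrow. *)
Definition sum_inj (I X Y : B) (a : p@[I × X × Y]) :
    @hom SumTotal (SumOb a) (SumOb (reindex p (assoc_inv I X Y) a)) :=
  lift SumFibration (pr1 I X) (sum_coprod (sum_fib a))
  ∘ arrow (sum_unit (sum_fib a)).

Lemma sum_inj0 (I X Y : B) (a : p@[I × X × Y]) : hom0 (sum_inj a) = pr1 I X.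
Proof. exact: comp_id_r. Qed.

Lemma sum_inj1 (I X Y : B) (a : p@[I × X × Y]) : hom1 (sum_inj a) = unit_arity I X Y.
Proof. exact: pr2_pair. Qed.

Lemma lift_inj (I X Y : B) (a : p@[I × X × Y]) :
  lift p (assoc_inv I X Y) a ∘ homt (sum_inj a) = id (carrier a).
Proof.
rewrite homt_comp homt_lift; apply: lift3_id.
by rewrite -comp_assoc /sum_base unit_base assocK.
Qed.

Lemma inj_lift (I X Y : B) (a : p@[I × X × Y]) :
  homt (sum_inj a) ∘ lift p (assoc_inv I X Y) a
  = id (carrier (reindex p (assoc_inv I X Y) a)).
Proof.
have o := over_comp (homt_over (sum_inj a)) (lift_over p (assoc_inv I X Y) a).
apply: (lift_mono (over_eq _ o) (over_id _)).
- by rewrite /hom01 /sum_base sum_inj0 sum_inj1 assoc_invK.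
- by rewrite comp_assoc lift_inj comp_id_l comp_id_r.
Qed.

Lemma sum_inj_epi (I X Y : B) (a : p@[I × X × Y]) (t : SumTotal)
    (k k' : @hom SumTotal (SumOb (reindex p (assoc_inv I X Y) a)) t) :
  hom0 k = hom0 k' -> k ∘ sum_inj a = k' ∘ sum_inj a -> k = k'.
Proof.
move=> e0 e; apply: sum_hom_ext => //.
- have := f_equal (@hom1 _ _) e.
  rewrite !hom1_comp /hom01 /sum_base sum_inj0 sum_inj1 => e1.
  rewrite -[LHS]comp_id_r -[RHS]comp_id_r -assoc_invK.
  by rewrite [LHS]comp_assoc [RHS]comp_assoc e1.
- have := f_equal (@homt _ _) e; rewrite (homt_comp k) (homt_comp k') => e1.
  rewrite -[LHS]comp_id_r -[RHS]comp_id_r -inj_lift.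
  rewrite [LHS]comp_assoc [RHS]comp_assoc.
  exact (f_equal (fun x => x ∘ lift p (assoc_inv I X Y) a) e1).
Qed.

Lemma sum_transpose_over (I X Y Z : B) (a : p@[I × X × Y]) (c : p@[I × Z])
    (f : sum_hom (SumOb a) (SumOb c)) :
  hom0 f = pr1 I X ->
  lies_over (proj p) ⟨id I ∘ pr1 I (X × Y), hom1 f ∘ assoc_inv I X Y⟩
    (homt f ∘ lift p (assoc_inv I X Y) a).
Proof.
move=> e; apply: over_eq (over_comp (homt_over f) (lift_over p _ a)).
rewrite /hom01 /sum_base /= e pair_comp -comp_assoc !pr1_pair comp_id_l.
by [].
Qed.

Definition sum_transpose (I X : B) (t : SumFibration@[I × X])
    (d : SumFibration@[I]) (f : hom t (reindexing SumFibration (pr1 I X) d)) :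
  {k : @hom SumFibration@[I] (sum_coprod t) d |
    fmap (reindexing SumFibration (pr1 I X)) k ∘ sum_unit t = f /\
    forall k', fmap (reindexing SumFibration (pr1 I X)) k' ∘ sum_unit t = f ->
               k' = k}.
Proof.
elim/sum_fib_rect: t f => Y a; elim/sum_fib_rect: d => Z c f.
have adj (k : @hom SumFibration@[I] (sum_coprod (sum_fib a)) (sum_fib c)) :
  fmap (reindexing SumFibration (pr1 I X)) k ∘ sum_unit (sum_fib a) = f <->
  arrow k ∘ sum_inj a = lift SumFibration (pr1 I X) (sum_fib c) ∘ arrow f.
  have e : lift SumFibration (pr1 I X) (sum_fib c) ∘
     arrow (fmap (reindexing SumFibration (pr1 I X)) k ∘ sum_unit (sum_fib a))
    = arrow k ∘ sum_inj a.
    by rewrite arrow_comp comp_assoc reindex_mapK -comp_assoc.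
  split; first by move=> <-; rewrite e.
  by move=> h; apply: vlift_mono; rewrite e.
pose F : sum_hom (SumOb a) (SumOb c) :=
  lift SumFibration (pr1 I X) (sum_fib c) ∘ arrow f.
have F0 : hom0 F = pr1 I X.
  apply/sum_over; exact: (over_vertical_comp f (lift_over SumFibration _ _)).
pose k : sum_hom (SumOb (reindex p (assoc_inv I X Y) a)) (SumOb c) :=
  @mk_sum_hom (SumOb (reindex p (assoc_inv I X Y) a)) (SumOb c)
    (id I) (hom1 F ∘ assoc_inv I X Y) _ (sum_transpose_over F0).
exists (@Vertical _ _ SumProj I (sum_coprod (sum_fib a)) (sum_fib c) k
          (proj2 (sum_over _ k) eq_refl)).
have kF : @comp SumTotal _ _ _ k (sum_inj a) = F.
{ apply: sum_hom_ext.
  - by rewrite F0 -(sum_inj0 a) -[RHS]comp_id_l.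
  - rewrite hom1_comp /hom01 /sum_base sum_inj0 sum_inj1 /=.
    by rewrite -comp_assoc assocK comp_id_r.
  - by rewrite homt_comp homt_mk -comp_assoc lift_inj comp_id_r. }
split; first exact/adj.
move=> k' /adj e; apply: vertical_ext; apply: sum_inj_epi.
- exact: (proj1 (sum_over _ _) (arrow_over k')).
- by rewrite e -/F -kF.
Qed.

Definition sum_coprod_functor (I X : B) :
    Functor SumFibration@[I × X] SumFibration@[I] :=
  universal_functor (@sum_transpose I X).

Definition sum_coprod_adj (I X : B) :
    Adjunction (sum_coprod_functor I X) (reindexing SumFibration (pr1 I X)) :=
  universal_adjunction (@sum_transpose I X).

Lemma sum_adj (I X Y : B) (a : p@[I × X × Y]) (d : SumFibration@[I])
    (k : @hom SumFibration@[I] (sum_coprod (sum_fib a)) d) :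
  arrow k ∘ sum_inj a
  = lift SumFibration (pr1 I X) d
    ∘ arrow (fmap (reindexing SumFibration (pr1 I X)) k ∘ sum_unit (sum_fib a)).
Proof.
by rewrite arrow_comp [RHS]comp_assoc reindex_mapK -comp_assoc.
Qed.

Lemma sum_comparison_base (I J X Y : B) (f : hom I J) :
  prod_map_id Y (prod_map_id X f) ∘ assoc_inv I X Y
  = assoc_inv J X Y ∘ prod_map_id (X × Y) f :> hom _ _.
Proof.
rewrite /prod_map_id /assoc_inv !pair_comp -!comp_assoc.
by rewrite !(pr1_pair, pr2_pair).
Qed.

Lemma sum_comparison_eq (I J X Y : B) (f : hom I J) (a : p@[J × X × Y]) :
  reindex p (assoc_inv I X Y) (reindex p (prod_map_id Y (prod_map_id X f)) a)
  = reindex p (prod_map_id (X × Y) f) (reindex p (assoc_inv J X Y) a).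
Proof. exact: reindex_square (sum_comparison_base X Y f). Qed.

Lemma sum_comparison_inj (I J X Y : B) (f : hom I J) (a : p@[J × X × Y])
    (w : @hom SumTotal
       (SumOb (reindex p (assoc_inv I X Y)
                 (reindex p (prod_map_id Y (prod_map_id X f)) a)))
       (SumOb (reindex p (prod_map_id (X × Y) f) (reindex p (assoc_inv J X Y) a)))) :
  hom0 w = id I -> hom1 w = pr2 I (X × Y) ->
  homt w = eqarrow (f_equal (@carrier _ _ _ _) (sum_comparison_eq f a)) ->
  lift SumFibration f (sum_coprod (sum_fib a))
  ∘ (w ∘ sum_inj (reindex p (prod_map_id Y (prod_map_id X f)) a))
  = sum_inj a ∘ lift SumFibration (prod_map_id X f) (sum_fib a).
Proof.
set a' := reindex p (prod_map_id Y (prod_map_id X f)) a.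
move=> e0 e1 et; apply: sum_hom_ext.
- transitivity (f ∘ (hom0 w ∘ hom0 (sum_inj a'))); first by [].
  rewrite e0 sum_inj0 comp_id_l.
  transitivity (hom0 (sum_inj a) ∘ prod_map_id X f); last by [].
  by rewrite sum_inj0 pr1_prod_map_id.
- transitivity (hom1 (w ∘ sum_inj a')); first exact: pr2_pair.
  rewrite hom1_comp e1 (hom1_comp (sum_inj a)) !sum_inj1.
  rewrite /hom01 /sum_base pr2_pair sum_inj1 /unit_arity pair_comp pr2_pair.
  by rewrite -[pr2 J X ∘ _ ∘ _]comp_assoc pr1_pair comp_assoc pr2_pair.
- rewrite homt_comp homt_lift (homt_comp w) et (homt_comp (sum_inj a)) homt_lift.
  rewrite -[LHS]comp_id_l -[id _](inj_lift a) -[LHS]comp_assoc.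
  congr (_ ∘ _); rewrite -arrow_eqarrow.
  have sq := lift_square (sum_comparison_eq f a) (sum_comparison_base X Y f).
  rewrite comp_assoc in sq.
  rewrite [lift p (prod_map_id _ _) _ ∘ _]comp_assoc comp_assoc.
  rewrite [lift p (assoc_inv _ _ _) _ ∘ _]comp_assoc.
  rewrite sq -comp_assoc.
  by rewrite (lift_inj a') comp_id_r.
Qed.

Lemma sum_beck_chevalley (I J X : B) (f : hom I J) (b : SumFibration@[J × X]) :
  is_iso (coprod_comparison sum_coprod_adj f b).
Proof.
elim/sum_fib_rect: b => Y a.
pose h := sum_comparison_eq f a.
pose e : sum_coprod_functor I X (reindexing SumFibration (prod_map_id X f) (sum_fib a))
  = reindexing SumFibration f (sum_coprod_functor J X (sum_fib a)) :=
  f_equal (@sum_fib I (X × Y)) h.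
suff -> : coprod_comparison sum_coprod_adj f (sum_fib a) = eqarrow e
  by exact: eqarrow_iso.
set c := coprod_comparison _ _ _.
have hc : lift SumFibration f (sum_coprod (sum_fib a))
    ∘ (arrow c ∘ sum_inj (reindex p (prod_map_id Y (prod_map_id X f)) a))
  = sum_inj a ∘ lift SumFibration (prod_map_id X f) (sum_fib a).
{ rewrite (sum_adj c) /c /coprod_comparison.
  rewrite (adjunction_transpose (sum_coprod_adj I X)).
  etransitivity; first exact (@lift_square_map _ SumFibration _ _ _ _ _ _ _ _
    (sum_coprod (sum_fib a)) (sum_fib a) _ (unit (sum_coprod_adj J X) (sum_fib a))
    (pr1_prod_map_id X f)).
  exact: comp_assoc. }
have he : lift SumFibration f (sum_coprod (sum_fib a))
    ∘ (arrow (eqarrow e) ∘ sum_inj (reindex p (prod_map_id Y (prod_map_id X f)) a))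
  = sum_inj a ∘ lift SumFibration (prod_map_id X f) (sum_fib a).
{ have [e0 [e1 et]] := sum_eqarrow h (f_equal (@carrier _ _ SumProj _) e).
  rewrite arrow_eqarrow; exact: sum_comparison_inj. }
have o0 := proj1 (sum_over _ _) (arrow_over c).
have o1 := proj1 (sum_over _ _) (arrow_over (eqarrow e)).
apply: vertical_ext; apply: sum_inj_epi; first by rewrite o0 -o1.
set a' := reindex p (prod_map_id Y (prod_map_id X f)) a.
have oi : @lies_over _ _ SumProj _ _ (pr1 I X) (sum_fib a')
            (sum_coprod (sum_fib a')) (sum_inj a').
  by apply/sum_over; exact: sum_inj0.
apply: (@lift_mono _ SumFibration I J _ f (pr1 I X) (sum_coprod (sum_fib a)) (sum_fib a')).
- exact: (vertical_over_comp c oi).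
- exact: (vertical_over_comp (eqarrow e) oi).
- by rewrite hc he.
Qed.

Definition SumCoproducts : SimpleCoproducts SumFibration :=
  Build_SimpleCoproducts sum_beck_chevalley.

End Sum.

(* Main.v *)
From Stdlib Require Import ssreflect.
Require Import Defs.
Open Scope cat_scope.

(** A vertical arrow [f^* a -> ⟨1, g⟩^* b] is the same thing as an arrow of the
    total category from [f^* a] to [b] over [⟨1, g⟩].  Hence a pair [(g, k)] as
    in the definition of a quantifier-free object is one arrow [K : f^* a -> b]
    whose base arrow is a section of the projection, and the composite of
    [⟨1, g⟩^* η] with [k] is [K] followed by the coproduct injection
    [b -> ∐ b], the unit followed by the cartesian arrow.  It therefore
    suffices that every arrow [f^* a -> ∐ b] of the total category factors
    uniquely through the injection ([quantifier_free_of_unique_factor]).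

    In the simple coproduct completion, the injection
    [(A × X, Y, b) -> (A, X × Y, b)] is invertible on the third component, and
    merely moves [X] from the base to the arity.  An arrow from [(J, 1, c)] to
    [(A, X × Y, b)] has an arity component [J × 1 -> X × Y]; since [J × 1] is
    [J], its first half is an arrow [J -> X] of the base, which can be moved
    back, in one way only ([sum_inj_unique_factor]).  Reindexing keeps the arity
    [1], so this applies to every reindexing of [(I, 1, alpha)]. *)

Section Factorization.
Variables (B : CartesianCategory) (q : SplitFibration B).

Lemma lies_over_unique {I J : B} {u v : hom I J} {x : q@[I]} {y : q@[J]}
    {f : hom (carrier x) (carrier y)} :
  lies_over (proj q) u f -> lies_over (proj q) v f -> u = v.
Proof.
rewrite /lies_over => -> e; have [i [_ eK]] := eqarrow_iso (carrier_over x).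
by rewrite -[LHS]comp_id_r -[RHS]comp_id_r -eK !comp_assoc e.
Qed.

Lemma lies_over_exists {I J : B} {x : q@[I]} {y : q@[J]}
    (f : hom (carrier x) (carrier y)) :
  exists u : hom I J, lies_over (proj q) u f.
Proof.
have [i [iK _]] := eqarrow_iso (carrier_over x).
exists (eqarrow (carrier_over y) ∘ fmap (proj q) f ∘ i).
by rewrite /lies_over -[RHS]comp_assoc iK comp_id_r.
Qed.

Variable S : SimpleCoproducts q.

Definition coprod_inj {A X : B} (b : q@[A × X]) :
    hom (carrier b) (carrier (coprod S A X b)) :=
  lift q (pr1 A X) (coprod S A X b) ∘ arrow (unit (coprod_adj S A X) b).

Lemma coprod_inj_over (A X : B) (b : q@[A × X]) :
  lies_over (proj q) (pr1 A X) (coprod_inj b).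
Proof. exact/over_vertical_comp/lift_over. Qed.

(** The lifts of [π] and [⟨1, g⟩] compose to the lift of the identity, which
    cancels the transport in [section_unit]. *)
Lemma arrow_section_unit (A X : B) (g : hom A X) (b : q@[A × X]) :
  arrow (section_unit S g b) = coprod_inj b ∘ lift q ⟨id A, g⟩ b.
Proof.
set e0 := reindex_section g (coprod S A X b).
have e := eq_trans e0 (eq_sym (reindex_id (coprod S A X b))).
have h : pr1 A X ∘ ⟨id A, g⟩ = id A by exact: pr1_pair.
rewrite /section_unit arrow_comp /coprod_inj -comp_assoc -reindex_mapK.
rewrite comp_assoc -(lift_fuse e h) lift_id !arrow_eqarrow eqarrow_comp.
by congr (eqarrow _ ∘ _); exact: ProofIrrelevance.proof_irrelevance.
Qed.

(** A vertical arrow into [⟨1, g⟩^* b], seen as an arrow into [b], remembers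
    [g], because the latter is a component of its base arrow. *)
Lemma lift_section_inj (A X : B) (x : q@[A]) (b : q@[A × X])
    (s t : {g : hom A X & hom x (reindexing q ⟨id A, g⟩ b)}) :
  lift q ⟨id A, projT1 s⟩ b ∘ arrow (projT2 s)
  = lift q ⟨id A, projT1 t⟩ b ∘ arrow (projT2 t) -> s = t.
Proof.
case: s t => [g k] [g' k'] /= e.
have o := over_vertical_comp k (lift_over q ⟨id A, g⟩ b).
have o' := over_vertical_comp k' (lift_over q ⟨id A, g'⟩ b).
have eg : g = g'.
  rewrite e in o; have := f_equal (comp (pr2 A X)) (lies_over_unique o o').
  by rewrite !pr2_pair.
by subst g'; rewrite (vlift_mono e).
Qed.

Lemma quantifier_free_of_unique_factor (I : B) (a : q@[I]) :
  (forall (A : B) (f : hom A I) (X : B) (b : q@[A × X])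
          (h : hom (carrier (reindex q f a)) (carrier (coprod S A X b))),
     exists! K, coprod_inj b ∘ K = h) ->
  quantifier_free S a.
Proof.
move=> factorH A f X b h.
have [K [hK uK]] := factorH A f X b (arrow h).
have [u oK] := lies_over_exists K.
(* The base arrow of [K] is a section, since [h] is vertical. *)
have eu : u = ⟨id A, pr2 A X ∘ u⟩.
  rewrite [LHS]pair_unique; congr (⟨_, _⟩).
  have o := over_comp (coprod_inj_over A X b) oK.
  rewrite hK in o; exact: lies_over_unique o (arrow_over h).
rewrite eu in oK.
exists (existT _ (pr2 A X ∘ u) (vfactor oK)); split.
- apply: vertical_ext.
  by rewrite arrow_comp arrow_section_unit -comp_assoc vfactorK hK.
- move=> s es; apply: lift_section_inj; rewrite vfactorK; apply: uK.
  by rewrite comp_assoc -arrow_section_unit es.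
Qed.

End Factorization.

(** The domain has arity [1], so [hom1 F] amounts to an arrow from the base [J];
    its first half supplies the second component of the base arrow of [K]. *)
Lemma sum_inj_unique_factor (B : CartesianCategory) (p : SplitFibration B)
    (J A X Y : B) (c : p@[J × one]) (b : p@[A × X × Y])
    (F : @hom (SumTotal p) (SumOb c) (SumOb (reindex p (assoc_inv A X Y) b))) :
  exists! K : @hom (SumTotal p) (SumOb c) (SumOb b), sum_inj b ∘ K = F.
Proof.
have sec : ⟨id J, bang J⟩ ∘ pr1 J one = id (J × one).
  apply: pair_ext; first by rewrite comp_assoc pr1_pair comp_id_l comp_id_r.
  by rewrite [LHS]bang_unique [RHS]bang_unique.
pose k0 : hom J (A × X) := ⟨hom0 F, pr1 X Y ∘ hom1 F ∘ ⟨id J, bang J⟩⟩.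
pose k1 : hom (J × one) Y := pr2 X Y ∘ hom1 F.
have o : lies_over (proj p) (@sum_base _ p (SumOb c) (SumOb b) k0 k1)
           (lift p (assoc_inv A X Y) b ∘ homt F).
  apply: over_eq (over_comp (lift_over p _ b) (homt_over F)).
  rewrite /assoc_inv /hom01 /sum_base /k0 /k1 /= !pair_comp.
  rewrite -!comp_assoc !pr1_pair !pr2_pair sec.
  by rewrite comp_id_r.
exists (mk_sum_hom o); split.
- apply: sum_hom_ext.
  + transitivity (hom0 (sum_inj b) ∘ k0); first by [].
    by rewrite sum_inj0 pr1_pair.
  + rewrite hom1_comp sum_inj1 /hom01 /sum_base /unit_arity /= pair_comp.
    rewrite -comp_assoc pr1_pair pr2_pair comp_assoc pr2_pair -comp_assoc sec.
    by rewrite comp_id_r -pair_unique.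
  + by rewrite homt_comp homt_mk comp_assoc inj_lift comp_id_l.
- move=> K eK; apply: sum_hom_ext.
  + rewrite /= /k0 -eK hom1_comp sum_inj1 /hom01 /sum_base /unit_arity.
    apply: pair_ext; rewrite ?pr1_pair ?pr2_pair.
      transitivity (hom0 (sum_inj b) ∘ hom0 K); first by [].
      by rewrite sum_inj0.
    rewrite comp_assoc pr1_pair -!comp_assoc (comp_assoc (pr1 _ _)) pr1_pair.
    by rewrite -comp_assoc pr1_pair comp_id_r.
  + rewrite /= /k1 -eK hom1_comp sum_inj1 /hom01 /sum_base /unit_arity.
    by rewrite comp_assoc !pr2_pair.
  + by rewrite homt_mk -eK homt_comp comp_assoc lift_inj comp_id_l.
Qed.

(* [I × 1] is identified with [I] by the projection, an isomorphism. *)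
Theorem proposition4p1 (B : CartesianCategory) (p : SplitFibration B) (I : B)
    (alpha : p@[I]) :
  quantifier_free (SumCoproducts p) (sum_fib (reindex p (pr1 I one) alpha)).
Proof.
apply: quantifier_free_of_unique_factor => A f X b.
elim/sum_fib_rect: b => Y b h.
exact: sum_inj_unique_factor.
Qed.
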